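(* Let $I$ be a set of positive integers, let $\ell$ be a positive integer with $\ell\notin I$, let $i$ be an even positive integer, and let $\psi\in\mathcal L^+_A(I)$ be equivalent to $[A_\ell]^i p$. Then $|\psi|\ge 2^{i/2}$.
   Context: Bimodal Kripke models $M=(W,R_1,R_2,\Pi)$, pointed models $(M,w)$. For a word $s=s_1\dots s_l\in\{1,2\}^*$, $w'$ is an $s$-successor of $w$ if there are $w=w_0,\dots,w_l=w'$ with $(w_{k-1},w_k)\in R_{s_k}$. A language $L\subseteq\{1,2\}^*$ yields the operator $[L]$: $M,w\models[L]\varphi$ iff $M,w'\models\varphi$ for every $s$-successor $w'$ of $w$ with $s\in L$. For $\ell\ge1$, $a^\ell_1$ and $a^\ell_2$ are the words of length $\ell$ over $\{1,2\}$ in which consecutive letters differ, starting with $1$ resp. $2$, and $A_\ell=\{a^\ell_1,a^\ell_2\}$; $[A_\ell]^i$ denotes $i$-fold iteration of $[A_\ell]$. For a set $I$ of positive integers, $\mathcal L^+_A(I)$ is the logic with formulas $\varphi::=p\mid\neg\varphi\mid\varphi\vee\varphi\mid[A_k]\varphi\ (k\in I)\mid[\{1\}]\varphi\mid[\{2\}]\varphi$ (the last two are the ordinary boxes $\Box_1,\Box_2$). $|\psi|$ is the number of nodes of the syntax tree; formulas are equivalent if they hold at the same pointed models. *)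

(* Defs.v *)
From mathcomp Require Import all_boot.

Set Implicit Arguments.
Unset Strict Implicit.
Unset Printing Implicit Defensive.

Inductive letter : Type := letter1 | letter2.

Definition other (a : letter) : letter :=
  match a with letter1 => letter2 | letter2 => letter1 end.

Definition word : Type := seq letter.

Definition language : Type := word -> Prop.

(* (W, R_1, R_2, Pi), with R_1 = access letter1 and R_2 = access letter2;
   valuation p w says that p is true at w. *)
Record model (Atom : Type) : Type := Model {
  world : Type;
  access : letter -> world -> world -> Prop;
  valuation : Atom -> world -> Prop
}.

Fixpoint successor (Atom : Type) (M : model Atom) (s : word)
    (w w' : world M) : Prop :=
  match s with
  | [::] => w = w'
  | a :: t => exists v : world M, access a w v /\ successor t v w'
  end.

Inductive formula (Atom : Type) : Type :=
  | Var of Atom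
  | Neg of formula Atom
  | Or of formula Atom & formula Atom
  | Box of language & formula Atom.

Arguments Var {Atom} _.

Fixpoint sat (Atom : Type) (M : model Atom) (w : world M)
    (f : formula Atom) : Prop :=
  match f with
  | Var p => valuation p w
  | Neg g => ~ sat w g
  | Or g h => sat w g \/ sat w h
  | Box L g => forall (s : word) (w' : world M),
                 L s -> successor s w w' -> sat w' g
  end.

Definition equivalent (Atom : Type) (f g : formula Atom) : Prop :=
  forall (M : model Atom) (w : world M), sat w f <-> sat w g.

(* A modal operator [L] is a single node of the syntax tree. *)
Fixpoint formula_size (Atom : Type) (f : formula Atom) : nat :=
  match f with
  | Var _ => 1
  | Neg g => (formula_size g).+1
  | Or g h => (formula_size g + formula_size h).+1
  | Box _ g => (formula_size g).+1
  end.

Fixpoint alternating (a : letter) (l : nat) : word :=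
  match l with
  | 0 => [::]
  | k.+1 => a :: alternating (other a) k
  end.

Definition lang_A (l : nat) : language :=
  fun s => s = alternating letter1 l \/ s = alternating letter2 l.

Definition lang_letter (a : letter) : language := fun s => s = [:: a].

(* The fragment L^+_A(I) of the formulas over all the operators [L]. *)
Inductive logic_A_plus (Atom : Type) (I : nat -> Prop) : formula Atom -> Prop :=
  | LA_var (p : Atom) : logic_A_plus I (Var p)
  | LA_neg (f : formula Atom) : logic_A_plus I f -> logic_A_plus I (Neg f)
  | LA_or (f g : formula Atom) :
      logic_A_plus I f -> logic_A_plus I g -> logic_A_plus I (Or f g)
  | LA_boxA (k : nat) (f : formula Atom) :
      I k -> logic_A_plus I f -> logic_A_plus I (Box (lang_A k) f)
  | LA_box1 (f : formula Atom) :
      logic_A_plus I f -> logic_A_plus I (Box (lang_letter letter1) f)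
  | LA_box2 (f : formula Atom) :
      logic_A_plus I f -> logic_A_plus I (Box (lang_letter letter2) f).

(* Main.v *)
(* Fix i/2 bits; they code a word of [A_l]^i made of blocks of length 2l, each
   alternating except for a repeated letter in its middle, the bits being the
   first letters of the blocks. Two chains of worlds read this word, one ending
   where p holds and one where it fails, so psi separates their first worlds.
   Following this separation down the syntax tree of psi leads to a leaf, and
   the operators met on the way read the word. At the start of a block detours
   of length k < l through the complementary letters join both chains, so that
   [A_k] cannot separate the chains there for k <> l: the operator read there
   is a box [{1}] or [{2}], which reveals the bit. Elsewhere the next letter is
   known from the block, or from the alternation of the word being read. Hence
   different bits lead to different leaves. *)

Require Import Defs.
From mathcomp Require Import all_boot.
From mathcomp Require Import zify.
From Stdlib Require Import Classical.

Set Implicit Arguments.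
Unset Strict Implicit.
Unset Printing Implicit Defensive.

Definition letter_of (b : bool) : letter := if b then letter1 else letter2.

Lemma letter_of_inj : injective letter_of.
Proof. by case; case. Qed.

Lemma other_letter_of b : other (letter_of b) = letter_of (~~ b).
Proof. by case: b. Qed.

Lemma other_neq a : other a <> a.
Proof. by case: a. Qed.

(** Used at a disjunction, to share out the codes it separates between its two disjuncts. *)
Lemma setU_of_or (T : finType) (C : {set T}) (P Q : T -> Prop) :
  (forall x, x \in C -> P x \/ Q x) ->
  exists C1 C2 : {set T}, [/\ C = C1 :|: C2,
    forall x, x \in C1 -> P x & forall x, x \in C2 -> Q x].
Proof.
move=> PQ.
have /fin_all_exists[f fP] x : exists b : bool, x \in C -> if b then P x else Q x.
  have [/PQ[] ?|] := boolP (x \in C); [by exists true|by exists false|by exists true].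
exists [set x in C | f x], [set x in C | ~~ f x]; split=> [|x|x].
- by apply/setP=> x; rewrite !inE -andb_orr orbN andbT.
- by rewrite inE => /andP[/fP]; case: (f x).
- by rewrite inE => /andP[/fP]; case: (f x).
Qed.

Fixpoint reads (f : nat -> letter) (t : nat) (s : word) : Prop :=
  if s is a :: s' then a = f t /\ reads f t.+1 s' else True.

Lemma size_alternating a k : size (alternating a k) = k.
Proof. by elim: k a => //= k IH a; rewrite IH. Qed.

Lemma alternating_in_lang_A a k : lang_A k (alternating a k).
Proof. by case: a; [left|right]. Qed.

Lemma lang_AP k s : lang_A k s -> exists a, s = alternating a k.
Proof. by case=> ->; eexists. Qed.

Lemma reads_alternating_head f t a k :
  0 < k -> reads f t (alternating a k) -> a = f t.
Proof. by case: k => // k _ []. Qed.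

Lemma reads_alternating_step f t a k u :
  reads f t (alternating a k) -> t <= u -> u.+1 < t + k -> f u.+1 = other (f u).
Proof.
elim: k t a => [|k IH] t a /=; first lia.
case=> ea rd le_tu lt_u; have [eq_ut|ne] := eqVneq u t; last by apply: (IH t.+1 (other a)) => //; lia.
case: k {IH} rd lt_u => [|k] /=; first lia.
by rewrite eq_ut => -[<- _] _; rewrite ea.
Qed.

Lemma reads_alternating f t k :
  (forall u, t <= u -> u.+1 < t + k -> f u.+1 = other (f u)) ->
  reads f t (alternating (f t) k).
Proof.
elim: k t => //= k IH t alt; split=> //.
case: k IH alt => [|k] IH alt //; rewrite -alt //; last lia.
by apply: IH => u le_u lt_u; apply: alt; lia.
Qed.

(** * Codes as words, and the model of two chains with detours *)

Section CodeModel.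

Variables (Atom : Type) (l m : nat).
Hypothesis l_gt0 : 0 < l.

Let d := l.*2.
Let n := d * m.

(* Each bit of [c] gives the first letter of a block of length [2l] which
   alternates except that its letters number [l - 1] and [l] coincide. *)
Definition code_word (c : seq bool) (t : nat) : letter :=
  letter_of (nth false c (t %/ l.*2) (+) odd (t %% l.*2 - (l <= t %% l.*2))).

Lemma code_word_start c t :
  code_word c (t %/ d * d) = letter_of (nth false c (t %/ d)).
Proof. by rewrite /code_word -/d mulnK ?modnMl ?sub0n ?addbF //; rewrite /d; lia. Qed.

Lemma code_word_same_block c c' t :
  code_word c (t %/ d * d) = code_word c' (t %/ d * d) ->
  code_word c t = code_word c' t.
Proof. by rewrite !code_word_start => /letter_of_inj; rewrite /code_word -/d => ->. Qed.

(** Alternation can fail only between two halves of length [l], of one block or of adjacent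
    blocks. *)
Lemma code_word_alternates c t :
  (t %% l).+1 < l -> code_word c t.+1 = other (code_word c t).
Proof.
have d_gt0 : 0 < d by rewrite /d; lia.
rewrite /code_word -/d other_letter_of (divn_eq t d).
set j := t %/ d; have := ltn_pmod t d_gt0; set r := t %% d => lt_r.
have -> : (j * d + r) %% l = r %% l.
  by rewrite -modnDml; have /eqP -> : l %| j * d by rewrite dvdn_mull // /d -muln2 dvdn_mulr.
move=> lt_rl; have [r1d r1l] : r.+1 < d /\ r.+1 <> l.
  split; last by move=> e; rewrite modn_small in lt_rl; lia.
  rewrite ltn_neqAle lt_r andbT; apply/eqP=> e.
  have er : r = l + l.-1 by move: e; rewrite /d; lia.
  by move: lt_rl; rewrite er modnDl modn_small; lia.
rewrite -addnS !divnMDl // !modnMDl !divn_small ?modn_small //.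
rewrite -addbN; congr (letter_of (_ (+) _)).
by lia.
Qed.

Lemma code_word_repeats c t :
  d %| t -> code_word c (t + l) = code_word c (t + l.-1).
Proof.
have d_gt0 : 0 < d by rewrite /d; lia.
move=> /dvdnP[j ->]; rewrite /code_word -/d !divnMDl // !modnMDl.
rewrite !divn_small ?modn_small; try by rewrite /d; lia.
by congr (letter_of (_ (+) _)); lia.
Qed.

(* [Some b] is the chain that reads the word of [c] and ends with p true iff
   [b]. The detour [None] reads instead, from the start of a block, the
   complement of fewer than [l] letters, and may join either chain. *)
Definition code_access (c : seq bool) (a : letter)
    (x y : option bool * nat) : Prop :=
  [/\ y.2 = x.2.+1, x.2 < n &
      [/\ x.1 <> None, y.1 = x.1 & a = code_word c x.2] \/
      [/\ x.1 = None \/ d %| x.2, (x.2 %% l).+1 < l & a = other (code_word c x.2)]].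

Definition code_model (c : seq bool) : model Atom :=
  Model (code_access c) (fun _ x => x <> (Some false, n)).

Notation succ c := (@successor Atom (code_model c)).
Notation holds c := (@sat Atom (code_model c)).

Lemma successor_chain c b s t :
  reads (code_word c) t s -> t + size s <= n ->
  succ c s (Some b, t) (Some b, t + size s).
Proof.
elim: s t => [|a s IH] t /=; first by rewrite addn0.
case=> -> rd le_n; exists (Some b, t.+1); split.
  by split=> //=; [lia | left].
by have := IH t.+1 rd; rewrite addSnnS; apply.
Qed.

(** Both chains read the same letters until the first detour step, and that step is open to both; so
    a path that takes one can start on either chain. *)
Lemma successor_chain_inv c b s t v :
  t <= n -> succ c s (Some b, t) v ->
  [/\ v = (Some b, t + size s), reads (code_word c) t s & t + size s <= n] \/
  (forall b', succ c s (Some b', t) v).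
Proof.
elim: s t => [|a s IH] t /=; first by move=> ? <-; left; rewrite addn0.
move=> _; case=> -[x u] [[/= -> lt_n acc] sc]; case: acc => [[_ ex ea]|[[//|dv] lt_l ea]].
  rewrite ex in sc; case: (IH _ lt_n sc) => [[ev rd le_n]|sc'].
    by left; rewrite -addSnnS.
  right=> b'; exists (Some b', t.+1); split; last exact: sc'.
  by split=> //; left.
right=> b'; exists (x, t.+1); split=> //.
by split=> //; right; split=> //; right.
Qed.

Lemma modn_offset t r : l %| t -> r < l -> (t + r) %% l = r.
Proof. by move=> l_t lt_r; rewrite -modnDml (eqP l_t) add0n modn_small. Qed.

(** All steps but the last go to [None]. The last one enters chain [b'], which needs [k < l]: the
    final letter of a half admits no detour step. *)
Lemma successor_detour c b' k t (x : option bool) :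
  d %| t -> t < n -> 0 < k < l ->
  succ c (alternating (other (code_word c t)) k) (x, t) (Some b', t + k).
Proof.
move=> dv lt_n /andP[k_gt0 lt_k].
have l_t : l %| t by apply: dvdn_trans dv; rewrite /d -muln2 dvdn_mulr.
have step r y : r.+1 < l -> (y = None \/ r = 0) -> forall z,
    code_access c (other (code_word c (t + r))) (y, t + r) (z, (t + r).+1).
  move=> lt_r hy z; split=> //=.
    have /dvdnP[j et] := dv; move: lt_n; rewrite et /n mulnC ltn_mul2l => /andP[d_gt0 lt_jm].
    apply: (@leq_trans (d * j.+1)); last by rewrite leq_mul2l lt_jm orbT.
    by rewrite mulnS mulnC /d; lia.
  right; split=> //; first by case: hy => [->|->]; [left | right; rewrite addn0].
  by rewrite modn_offset //; lia.
suff gen j r y : r + j = k -> 0 < j -> (y = None \/ r = 0) ->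
    succ c (alternating (other (code_word c (t + r))) j) (y, t + r) (Some b', t + k).
  by have := gen k 0 x; rewrite addn0; apply=> //; right.
elim: j r y => // j IH r y e _ hy /=.
case: j IH e => [|j] IH e.
  exists (Some b', (t + r).+1); split; first by apply: step => //; lia.
  by rewrite /=; congr (_, _); lia.
exists (None, (t + r).+1); split; first by apply: step => //; lia.
rewrite -code_word_alternates -?addnS; first by apply: IH => //; [lia | left].
by rewrite modn_offset //; lia.
Qed.

(** * Formulas that separate the two chains *)

Definition separates c (f : formula Atom) t : Prop :=
  ~ (holds c (Some true, t) f <-> holds c (Some false, t) f).

Lemma separates_var c q t : separates c (Var q) t -> t = n.
Proof.
move=> sep; apply/eqP; apply: contraT => /eqP ne; case: sep => /=.
by split=> _ // -[].
Qed.

Lemma separates_neg c f t : separates c (Neg f) t -> separates c f t.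
Proof. by rewrite /separates /=; tauto. Qed.

Lemma separates_or c f g t :
  separates c (Or f g) t -> separates c f t \/ separates c g t.
Proof.
rewrite /separates /=.
case: (classic (holds c (Some true, t) f <-> holds c (Some false, t) f)); tauto.
Qed.

(** A successor reached through a detour is shared by both chains, so only a word read along the
    chains can make the difference. *)
Lemma separates_box c (L : language) f t :
  t <= n -> separates c (Box L f) t ->
  exists s, [/\ L s, reads (code_word c) t s, t + size s <= n &
                separates c f (t + size s)].
Proof.
move=> le_tn sep; apply: NNPP => no; apply: sep.
suff imp b b' : holds c (Some b, t) (Box L f) -> holds c (Some b', t) (Box L f).
  by split; apply: imp.
move=> H s v Ls sc; case: (successor_chain_inv le_tn sc) => [[ev rd le_n]|sc']; last first.
  exact: H Ls (sc' b).
have [bb'|ne] := eqVneq b' b; first by apply: H Ls _; rewrite -bb'.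
have nsep : holds c (Some true, t + size s) f <-> holds c (Some false, t + size s) f.
  by apply: NNPP => sep; apply: no; exists s.
have hb : holds c (Some b, t + size s) f.
  by apply: H Ls _; apply: successor_chain.
by rewrite ev; case: b b' ne hb {H sc ev} => -[]//= _ /nsep.
Qed.

(* At the start of a block, [A_k] reaches the same two worlds of the chains
   from both chains when [k < l], and reads neither chain when [k > l]. *)
Lemma separates_box_lang_A c k f t :
  0 < k -> k <> l -> t <= n -> separates c (Box (lang_A k) f) t -> ~~ (d %| t).
Proof.
move=> k_gt0 ne_kl le_tn sep; apply/negP=> dv.
case: (separates_box le_tn sep) => s [/lang_AP[a ->] rd].
rewrite size_alternating => le_n sepf.
have lt_kl : k < l.
  (* For [k > l] the alternating word would cross the repeated letter in the middle of the block. *)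
  rewrite ltnNge; apply/negP=> le_lk.
  have /= := reads_alternating_step (u := t + l.-1) rd.
  rewrite -addnS prednK // code_word_repeats // => H.
  by apply: (@other_neq (code_word c (t + l.-1))); rewrite -H //; lia.
apply: sep.
(* If the box held on one chain, detours would give [f] at both end worlds, against [sepf]. *)
have no b : ~ holds c (Some b, t) (Box (lang_A k) f).
  move=> H; apply: sepf.
  have Hb b' : holds c (Some b', t + k) f.
    apply: H (alternating_in_lang_A (other (code_word c t)) k) _.
    by apply: successor_detour => //; lia.
  by split.
by split=> /no.
Qed.

(** * Truth of the iterated operator on each chain *)

Lemma not_block_start t r : l %| t -> 0 < r < l -> ~~ (d %| t + r).
Proof.
move=> l_t r_bd; apply/negP=> dv.
have /eqP : l %| t + r by apply: dvdn_trans dv; rewrite /d -muln2 dvdn_mulr.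
by rewrite modn_offset //; lia.
Qed.

Lemma successor_inside_half c b s t r v :
  l %| t -> 0 < r -> r + size s <= l -> succ c s (Some b, t + r) v ->
  v = (Some b, t + r + size s).
Proof.
move=> l_t; elim: s r => [|a s IH] r r_gt0 /= le_l; first by rewrite addn0.
case=> -[x u] [[/= -> lt_n [[_ -> _]|[[//|dv] _ _]]]] sc.
  by rewrite -addnS in sc; rewrite (IH _ _ _ sc) //=; [congr (_, _)|]; lia.
by move: dv; rewrite (negPf (not_block_start l_t _)) //; lia.
Qed.

(** The word stays complementary to the code within the half, so it never follows a chain, and the
    last letter of the half admits no detour step. *)
Lemma alternating_detour_stuck c j t r x v :
  l %| t -> 0 < r < l -> r + j = l ->
  ~ succ c (alternating (other (code_word c (t + r))) j) (x, t + r) v.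
Proof.
move=> l_t; elim: j r x => [|j IH] r x /= r_bd e; first by lia.
case=> -[y u] [[/= -> lt_n acc] sc].
case: acc => [[_ _ ea]|[_ lt_l _]]; first exact: (@other_neq (code_word c (t + r))).
rewrite modn_offset // in lt_l; last lia.
rewrite -code_word_alternates -?addnS in sc; last by rewrite modn_offset; lia.
by apply: IH sc; lia.
Qed.

Lemma lang_A_successor c b s t v :
  l %| t -> lang_A l s -> succ c s (Some b, t) v -> v = (Some b, t + l).
Proof.
move=> l_t /lang_AP[a ->]; have [k ek] : exists k, l = k.+1 by exists l.-1; lia.
rewrite [X in alternating a X]ek /=.
case=> -[x u] [[/= -> lt_n [[_ -> _]|[_ lt_l ->]]]] sc.
  rewrite -addn1 in sc; have := successor_inside_half l_t _ _ sc.
  rewrite size_alternating => ->; [congr (_, _)| |]; lia.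
rewrite (eqP l_t) in lt_l.
case: (@alternating_detour_stuck c k t 1 x v l_t) => //.
by rewrite addn1 code_word_alternates // (eqP l_t).
Qed.

Lemma true_chain_sat c q i j :
  n = l * (i + j) -> holds c (Some true, l * i) (iter j (Box (lang_A l)) (Var q)).
Proof.
elim: j i => [|j IH] i e /=; first by case.
move=> s v Ls /(lang_A_successor (dvdn_mulr i (dvdnn l)) Ls) ->.
by rewrite addnC -mulnS; apply: IH; rewrite addSnnS.
Qed.

Lemma false_chain_unsat c q i j :
  n = l * (i + j) -> ~ holds c (Some false, l * i) (iter j (Box (lang_A l)) (Var q)).
Proof.
elim: j i => [|j IH] i e /=; first by rewrite e addn0; apply.
pose s := alternating (code_word c (l * i)) l.
move/(_ s (Some false, l * i + size s)).
rewrite size_alternating addnC -mulnS => H; apply: (IH i.+1); first by rewrite addSnnS.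
apply: H; first exact: alternating_in_lang_A.
have -> : l * i.+1 = l * i + size s by rewrite size_alternating mulnS addnC.
apply: successor_chain; last first.
  by rewrite size_alternating e addnC -mulnS leq_mul2l; lia.
apply: reads_alternating => u le_u lt_u; apply: code_word_alternates.
rewrite -(subnKC le_u) modn_offset ?dvdn_mulr //; lia.
Qed.

(** * Counting codes down the syntax tree *)

Lemma code_word_inj (c c' : m.-tuple bool) :
  (forall u, u < n -> code_word c u = code_word c' u) -> c = c'.
Proof.
have d_gt0 : 0 < d by rewrite /d; lia.
move=> eq_w; apply/val_inj/(@eq_from_nth _ false) => [|j]; rewrite !size_tuple // => lt_jm.
apply: letter_of_inj; have := code_word_start c (j * d).
have := code_word_start c' (j * d); rewrite mulnK // => <- <-.
by apply: eq_w; rewrite /n mulnC ltn_mul2l d_gt0.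
Qed.

(** The induction claim: [C] gathers codes that arrive at one subformula after reading the same [t]
    letters. *)
Definition separated_codes_bounded (f : formula Atom) : Prop :=
  forall t (C : {set m.-tuple bool}), t <= n ->
  (forall c, c \in C -> separates c f t) ->
  {in C &, forall (c c' : m.-tuple bool) u, u < t -> code_word c u = code_word c' u} ->
  #|C| <= formula_size f.

(** The box itself names the letter at [t], so agreement extends by one letter. *)
Lemma separated_codes_bounded_letter a f :
  separated_codes_bounded f -> separated_codes_bounded (Box (lang_letter a) f).
Proof.
move=> IH t C le_tn sep agree; apply: leqW.
have [->|[c0 C_c0]] := set_0Vmem C; first by rewrite cards0.
have step c : c \in C -> [/\ a = code_word c t, t.+1 <= n & separates c f t.+1].
  by move=> /sep /(separates_box le_tn)[_ [-> []]]; rewrite addn1.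
have [_ lt_tn _] := step c0 C_c0.
apply: IH lt_tn _ _ => [c /step[]//|c c' Cc Cc' u].
rewrite ltnS leq_eqVlt => /orP[/eqP->|]; last exact: agree.
by have [<- _ _] := step c Cc; have [<- _ _] := step c' Cc'.
Qed.

(** As [t] is not a block start, the letters before it fix the bit of the current block, hence the
    letter at [t]; alternation fixes the rest of the word read. *)
Lemma separated_codes_bounded_lang_A k f : 0 < k -> k <> l ->
  separated_codes_bounded f -> separated_codes_bounded (Box (lang_A k) f).
Proof.
move=> k_gt0 ne_kl IH t C le_tn sep agree; apply: leqW.
have [->|[c0 C_c0]] := set_0Vmem C; first by rewrite cards0.
have step c : c \in C ->
    [/\ reads (code_word c) t (alternating (code_word c t) k),
        t + k <= n, separates c f (t + k) & ~~ (d %| t)].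
  move=> /sep sepc; have [s [/lang_AP[a ->] rd]] := separates_box le_tn sepc.
  rewrite size_alternating -(reads_alternating_head k_gt0 rd) => ? ?; split=> //.
  exact: separates_box_lang_A sepc.
have [_ le_n _ nd] := step c0 C_c0.
apply: IH le_n _ _ => [c /step[]//|c c' Cc Cc'].
have eq_t : code_word c t = code_word c' t.
  apply: code_word_same_block; apply: agree => //.
  rewrite ltn_neqAle leq_divM andbT; apply: contra nd => /eqP <-.
  exact: dvdn_mull.
have [rd _ _ _] := step c Cc; have [rd' _ _ _] := step c' Cc'.
elim=> [|u IHu] lt_u; first by case: (t) eq_t agree => // t' _; apply.
have [lt_ut|le_tu] := ltnP u.+1 t; first exact: agree.
have [<-//|ne] := eqVneq t u.+1.
by rewrite (reads_alternating_step rd) ?(reads_alternating_step rd') ?IHu //; lia.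
Qed.

Lemma separated_codes_boundedP (I : nat -> Prop) f :
  (forall k, I k -> 0 < k /\ k <> l) -> logic_A_plus I f ->
  separated_codes_bounded f.
Proof.
move=> I_bd; elim=> {f} [q|f _ IH|f g _ IHf _ IHg|k f /I_bd[k_gt0 ne_kl] _ IH|f _ IH|f _ IH].
(* A variable separates only at [t = n], where the letters read determine the code. *)
- move=> t C le_tn sep agree; apply/card_le1_eqP => c c' Cc Cc'; apply: code_word_inj.
  by rewrite -(separates_var (sep _ Cc)); apply: agree.
- move=> t C le_tn sep agree; apply: leqW.
  by apply: IH le_tn _ agree => c /sep /separates_neg.
- move=> t C le_tn sep agree.
  have [C1 [C2 [eC sep1 sep2]]] := setU_of_or (fun c Cc => separates_or (sep c Cc)).
  rewrite eC; apply/leqW/(leq_trans (leq_card_setU C1 C2))/leq_add.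
    by apply: IHf le_tn sep1 _ => c c' Cc Cc'; apply: agree; rewrite eC inE ?Cc ?Cc'.
  by apply: IHg le_tn sep2 _ => c c' Cc Cc'; apply: agree; rewrite eC inE ?Cc ?Cc' orbT.
- exact: separated_codes_bounded_lang_A.
- exact: separated_codes_bounded_letter.
- exact: separated_codes_bounded_letter.
Qed.

End CodeModel.

Theorem theorem9 (Atom : Type) (p : Atom) (I : nat -> Prop) (l i : nat)
    (psi : formula Atom) :
  (forall k : nat, I k -> 0 < k) ->
  0 < l -> ~ I l ->
  0 < i -> ~~ odd i ->
  logic_A_plus I psi ->
  equivalent psi (iter i (Box (lang_A l)) (Var p)) ->
  2 ^ (i./2) <= formula_size psi.
Proof.
move=> I_gt0 l_gt0 nIl _ even_i Lpsi eq_psi.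
have n_eq : l.*2 * i./2 = l * (0 + i).
  by rewrite add0n -{2}(even_halfK even_i); lia.
have I_bd k : I k -> 0 < k /\ k <> l.
  by move=> Ik; split; [exact: I_gt0 | move=> ekl; rewrite ekl in Ik].
have -> : 2 ^ i./2 = #|[set: i./2.-tuple bool]| by rewrite cardsT card_tuple card_bool.
(* At position 0 nothing has been read, so all codes agree. *)
apply: (separated_codes_boundedP l_gt0 I_bd Lpsi (leq0n _)) => // c _ sep.
have := @true_chain_sat Atom l i./2 l_gt0 c p 0 i n_eq.
have := @false_chain_unsat Atom l i./2 l_gt0 c p 0 i n_eq.
rewrite muln0 => false_unsat true_sat; apply: false_unsat.
by apply/eq_psi/sep/eq_psi.
Qed.
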